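(* Let $F>0$ be fixed and, for integers $N\ge 2$ and $\varepsilon=1/N$, let $y_F$ be the straight chain with nearest neighbor interatomic spacing $F\varepsilon$. If $\phi'(2F)\ge 0$ and $\phi''(2F)\le 0$, then, as $\varepsilon\to0$, $$\inf_{u\in\mathcal U\setminus\{0\}}\frac{\delta^2\mathcal E^{\mathrm a}(y_F)[u,u]}{\|u'\|_{\ell^2_\varepsilon}^2}=\begin{cases}\min\left\{\phi''(F)+4\,\phi''(2F)+\mathcal O(\varepsilon^2),\ \dfrac{\phi'(F)}{F}\right\}&\text{if }N\text{ is even},\\[2mm]\min\left\{\phi''(F)+4\,\phi''(2F)+\mathcal O(\varepsilon^2),\ \dfrac{\phi'(F)}{F}+\mathcal O(\varepsilon)\right\}&\text{if }N\text{ is odd}.\end{cases}$$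
   Context: Let $\varepsilon=1/N$. $\mathcal Y$ is the set of sequences $y=\{y_\ell\}_{\ell\in\mathbb Z}$, $y_\ell\in\mathbb R^2$, with $y_{\ell+N}=y_\ell+(y_N-y_0)$ for all $\ell$. $\mathcal U$ is the set of $N$-periodic sequences $u=\{u_\ell\}_{\ell\in\mathbb Z}$ in $\mathbb R^2$ with $\sum_{\ell=1}^N u_\ell=0$. Backward difference: $y'_\ell=(y_\ell-y_{\ell-1})/\varepsilon$. $\|\cdot\|$ is the Euclidean norm on $\mathbb R^2$ and $\|v\|_{\ell^2_\varepsilon}=\left(\varepsilon\sum_{\ell=1}^N\|v_\ell\|^2\right)^{1/2}$. The pair potential $\phi:(0,\infty)\to\mathbb R$ is twice continuously differentiable. The atomistic energy is $\mathcal E^{\mathrm a}(y)=\varepsilon\sum_{\ell=1}^N[\phi(\|y'_\ell\|)+\phi(\|y'_{\ell+1}+y'_\ell\|)]$. The second variation is $\delta^2\mathcal E(y)[u,v]=\frac{\partial^2}{\partial s\,\partial t}\mathcal E(y+su+tv)\big|_{s=t=0}$. The straight chain is $(y_F)_\ell=(F\varepsilon\ell,0)$ (up to translation along the line). $\mathcal O(\varepsilon^k)$ denotes a real quantity $r_N$ with $|r_N|\le C\varepsilon^k$ for all sufficiently large $N$ of the given parity, with $C$ depending only on $\phi$ and $F$. *)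

(* Defs.v *)
From Stdlib Require Import Reals ZArith.
From Coquelicot Require Import Coquelicot.
Open Scope R_scope.

(* [prod_norm] is [sqrt (|v1|^2 + |v2|^2)], so [norm] below is Euclidean. *)
Definition vec2 : NormedModule R_AbsRing :=
  prod_NormedModule R_AbsRing R_NormedModule R_NormedModule.

Definition vseq : Type := Z -> vec2.

Definition eps (N : nat) : R := 1 / INR N.

Definition bdiff (N : nat) (y : vseq) : vseq :=
  fun l => scal (/ eps N) (minus (y l) (y (l - 1)%Z)).

Definition norm_l2eps (N : nat) (v : vseq) : R :=
  sqrt (eps N * sum_n_m (fun l : nat => norm (v (Z.of_nat l)) ^ 2) 1 N).

Definition is_deformation (N : nat) (y : vseq) : Prop :=
  forall l : Z,
    y (l + Z.of_nat N)%Z = plus (y l) (minus (y (Z.of_nat N)) (y 0%Z)).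

Definition is_displacement (N : nat) (u : vseq) : Prop :=
  (forall l : Z, u (l + Z.of_nat N)%Z = u l) /\
  sum_n_m (fun l : nat => u (Z.of_nat l)) 1 N = zero.

(* A potential on (0, oo) is encoded as a function on R whose values on
   (-oo, 0] are arbitrary; regularity is only required on (0, oo). *)
Definition C2_on_pos (phi : R -> R) : Prop :=
  forall x : R, 0 < x ->
    ex_derive phi x /\ ex_derive (Derive phi) x /\
    continuous (Derive_n phi 2) x.

Definition atomistic_energy (phi : R -> R) (N : nat) (y : vseq) : R :=
  eps N * sum_n_m (fun l : nat =>
    phi (norm (bdiff N y (Z.of_nat l))) +
    phi (norm (plus (bdiff N y (Z.of_nat l + 1)%Z)
                    (bdiff N y (Z.of_nat l))))) 1 N.

Definition second_variation (E : vseq -> R) (y u v : vseq) : R :=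
  Derive (fun s : R => Derive (fun t : R =>
    E (fun l => plus (plus (y l) (scal s (u l))) (scal t (v l)))) 0) 0.

Definition straight_chain (N : nat) (F c : R) : vseq :=
  (* translated by c along the line *)
  fun l => (c + F * eps N * IZR l, 0).

Definition stability_constant (phi : R -> R) (N : nat) (y : vseq) : Rbar :=
  Glb_Rbar (fun q : R => exists u : vseq,
    is_displacement N u /\ (exists l : Z, u l <> zero) /\
    q = second_variation (atomistic_energy phi N) y u u
        / norm_l2eps N (bdiff N u) ^ 2).

(* O(eps^k) along the integers N satisfying [P]. *)
Definition bigO_eps (k : nat) (P : nat -> Prop) (r : nat -> R) : Prop :=
  exists (C : R) (N0 : nat), forall N : nat,
    (N0 <= N)%nat -> P N -> Rabs (r N) <= C * eps N ^ k.

Lemma norm_vec2E (v : vec2) : norm v = sqrt (fst v ^ 2 + snd v ^ 2).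
Proof.
change (sqrt (Rabs (fst v) ^ 2 + Rabs (snd v) ^ 2) = sqrt (fst v ^ 2 + snd v ^ 2)).
now rewrite 2!RPow_abs, 2!(Rabs_pos_eq (_ ^ 2)) by apply pow2_ge_0.
Qed.

Lemma straight_chain_deformation (N : nat) (F c : R) :
  is_deformation N (straight_chain N F c).
Proof.
intro l.
apply injective_projections; cbn; rewrite ?plus_IZR; ring.
Qed.

Lemma deformation_plus_displacement (N : nat) (y u : vseq) (s : R) :
  is_deformation N y -> is_displacement N u -> is_deformation N (fun l => plus (y l) (scal s (u l))).
Proof.
intros Hy [Hu _] l.
assert (HN := Hu 0%Z); rewrite Z.add_0_l in HN.
rewrite Hy, Hu, HN.
apply injective_projections; cbn; ring.
Qed.

(* Main.v *)
Require Import Defs.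
From Stdlib Require Import Reals ZArith Lra Lia FunctionalExtensionality.
From Coquelicot Require Import Coquelicot.
Open Scope R_scope.

(** The components of [u'] decouple in the Hessian at a straight chain. With
    [S = sum w_l^2] and [T = sum (w_l + w_(l+1))^2], the longitudinal part is
    [phi''(F) S + phi''(2F) T] and the transverse part is
    [phi'(F)/F S + phi'(2F)/(2F) T]. By the signs of [phi''(2F)] and [phi'(2F)],
    the infimum is governed by the supremum and by the infimum of the Rayleigh
    quotient [T/S], which lies in [[0,4]]. The cosine modes [cos (2 pi k l / N)]
    realize the values [2 + 2 cos (2 pi k / N)]: [k = 1] gives [4 - O(eps^2)],
    [k = N/2] gives [0], and [k = (N-1)/2] gives [O(eps^2)]. *)

(** * Second derivatives at zero along a line *)

(** [Derive] is total and cannot certify differentiability, so the relation carries a genuine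
    derivative [g]. It is local because [phi] is regular only on the positive half-line. *)
Definition has_derive2_0 (f : R -> R) (l : R) : Prop :=
  exists g : R -> R, locally 0 (fun s => is_derive f s (g s)) /\ is_derive g 0 l.

Lemma has_derive2_0_plus (f g : R -> R) (l m : R) :
  has_derive2_0 f l -> has_derive2_0 g m ->
  has_derive2_0 (fun s => f s + g s) (l + m).
Proof.
intros [f' [Hf Hf']] [g' [Hg Hg']].
exists (fun s => f' s + g' s); split.
- generalize (filter_and _ _ Hf Hg); apply filter_imp.
  intros s [H1 H2]; exact (is_derive_plus f g s _ _ H1 H2).
- exact (is_derive_plus f' g' 0 _ _ Hf' Hg').
Qed.

Lemma has_derive2_0_scal (k : R) (f : R -> R) (l : R) :
  has_derive2_0 f l -> has_derive2_0 (fun s => k * f s) (k * l).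
Proof.
intros [f' [Hf Hf']].
exists (fun s => k * f' s); split.
- revert Hf; apply filter_imp; intros s H; exact (is_derive_scal f s k _ H).
- exact (is_derive_scal f' 0 k _ Hf').
Qed.

Lemma has_derive2_0_ext (f g : R -> R) (l : R) :
  (forall s, f s = g s) -> has_derive2_0 f l -> has_derive2_0 g l.
Proof.
intros E [f' [Hf Hf']]; exists f'; split; [| exact Hf'].
revert Hf; apply filter_imp; intros s; apply is_derive_ext, E.
Qed.

Lemma has_derive2_0_sum (f : nat -> R -> R) (l : nat -> R) (n : nat) :
  (forall i, has_derive2_0 (f i) (l i)) ->
  has_derive2_0 (fun s => sum_n_m (fun i => f i s) 1 n) (sum_n_m l 1 n).
Proof.
intros H; induction n as [|n IH].
- rewrite sum_n_m_zero by lia.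
  apply has_derive2_0_ext with (fun _ => 0).
  + intros s; now rewrite sum_n_m_zero by lia.
  + exists (fun _ => 0); split; [apply filter_forall; intros s |];
      exact (is_derive_const (V := R_NormedModule) 0 _).
- rewrite sum_n_Sm by lia.
  apply has_derive2_0_ext with (fun s => sum_n_m (fun i => f i s) 1 n + f (S n) s).
  + intros s; now rewrite (sum_n_Sm (fun i => f i s)) by lia.
  + now apply has_derive2_0_plus.
Qed.

(** With equal directions the energy depends on [s + t] only, so the mixed partial derivative is an
    ordinary second derivative. *)
Lemma Derive_Derive_translate (h : R -> R) (l : R) :
  has_derive2_0 h l ->
  Derive (fun s => Derive (fun t => h (s + t)) 0) 0 = l.
Proof.
intros [g [Hg Hl]]; apply is_derive_unique.
apply is_derive_ext_loc with (2 := Hl).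
revert Hg; apply filter_imp; intros s Hs; symmetry; apply is_derive_unique.
replace (g s) with (scal 1 (g s)) by exact (Rmult_1_l (g s)).
apply (is_derive_comp (V := R_NormedModule) h (fun t => s + t) 0).
- now rewrite Rplus_0_r.
- auto_derive; trivial.
Qed.

(** The bond length expands as [X + s a + s^2 b^2 / (2 X) + O(s^3)]: stretching along the bond meets
    [phi''], while a transverse motion acts only at second order, through [phi' / X]. *)
Lemma has_derive2_0_radial (phi : R -> R) (X a b : R) :
  C2_on_pos phi -> 0 < X ->
  has_derive2_0 (fun s => phi (sqrt ((X + s * a) ^ 2 + (s * b) ^ 2)))
    (Derive_n phi 2 X * a ^ 2 + Derive phi X / X * b ^ 2).
Proof.
intros Hphi HX.
set (rho := fun s => sqrt ((X + s * a) ^ 2 + (s * b) ^ 2)).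
exists (fun s => Derive phi (rho s) * (((X + s * a) * a + s * b ^ 2) / rho s)); split.
(* For small [s] the longitudinal component stays positive, so [rho s] stays where both [phi] and
   the square root are differentiable. *)
- assert (Hloc : locally 0 (fun s => 0 < X + s * a)).
  { assert (Hc : continuous (fun s => X + s * a) 0).
    { apply (ex_derive_continuous (V := R_NormedModule)); auto_derive; trivial. }
    apply (Hc (fun y => 0 < y)), (open_gt 0); lra. }
  revert Hloc; apply filter_imp; intros s Hs.
  assert (Hpos : 0 < (X + s * a) ^ 2 + (s * b) ^ 2).
  { assert (0 <= (s * b) ^ 2) by apply pow2_ge_0.
    assert (0 < (X + s * a) ^ 2) by (apply pow_lt, Hs); lra. }
  assert (Hrho : 0 < rho s) by (apply sqrt_lt_R0, Hpos).
  destruct (Hphi _ Hrho) as [D _].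
  unfold rho in *; auto_derive.
  + replace ((X + s * a) * ((X + s * a) * 1) + s * b * (s * b * 1))
      with ((X + s * a) ^ 2 + (s * b) ^ 2) by ring.
    now repeat split.
  + replace ((X + s * a) * ((X + s * a) * 1) + s * b * (s * b * 1))
      with ((X + s * a) ^ 2 + (s * b) ^ 2) by ring.
    change (fun x : R => phi x) with phi; field; lra.
- destruct (Hphi _ HX) as [_ [D _]].
  assert (HX2 : 0 < X ^ 2) by now apply pow_lt.
  unfold rho; auto_derive;
    replace ((X + 0 * a) * ((X + 0 * a) * 1) + 0 * b * (0 * b * 1))
      with (X ^ 2) by ring; rewrite sqrt_pow2 by lra.
  + repeat split; trivial; lra.
  + change (Derive_n phi 2 X) with (Derive (fun x => Derive phi x) X).
    field; lra.
Qed.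

(** * Sums over one period *)

Definition csum (N : nat) (p : Z -> R) : R :=
  sum_n_m (fun l : nat => p (Z.of_nat l)) 1 N.

Lemma csum_ext (N : nat) (p q : Z -> R) :
  (forall l, p l = q l) -> csum N p = csum N q.
Proof. intros H; now apply sum_n_m_ext; intros. Qed.

Lemma csum_plus (N : nat) (p q : Z -> R) :
  csum N (fun l => p l + q l) = csum N p + csum N q.
Proof. exact (sum_n_m_plus (G := R_AbelianMonoid) _ _ 1 N). Qed.

Lemma csum_scal (N : nat) (k : R) (p : Z -> R) :
  csum N (fun l => k * p l) = k * csum N p.
Proof. exact (sum_n_m_mult_l (K := R_Ring) k _ 1 N). Qed.

Lemma csum_le (N : nat) (p q : Z -> R) :
  (forall l, p l <= q l) -> csum N p <= csum N q.
Proof. intros H; now apply sum_n_m_le. Qed.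

Lemma csum_0 (N : nat) : csum N (fun _ => 0) = 0.
Proof. exact (sum_n_m_const_zero (G := R_AbelianMonoid) 1 N). Qed.

Lemma csum_nonneg (N : nat) (p : Z -> R) :
  (forall l, 0 <= p l) -> 0 <= csum N p.
Proof. intros H; rewrite <- (csum_0 N); now apply csum_le. Qed.

Lemma csum_S (N : nat) (p : Z -> R) :
  csum (S N) p = csum N p + p (Z.of_nat (S N)).
Proof.
unfold csum; exact (sum_n_Sm (G := R_AbelianMonoid) _ 1 N (le_n_S _ _ (Nat.le_0_l N))).
Qed.

Lemma csum_eq0 (N : nat) (p : Z -> R) :
  (forall l, 0 <= p l) -> csum N p = 0 ->
  forall n, (1 <= n <= N)%nat -> p (Z.of_nat n) = 0.
Proof.
intros Hp; induction N as [|N IH]; intros H0 n Hn; [lia |].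
rewrite csum_S in H0.
assert (H1 := csum_nonneg N p Hp); assert (H2 := Hp (Z.of_nat (S N))).
destruct (Nat.eq_dec n (S N)) as [-> | Hne]; [lra |].
apply IH; [lra | lia].
Qed.

(** Both sides add [p] over [1, ..., N + 1]. Periodicity is kept out because it would tie [p] to [N]
    and block the induction. *)
Lemma csum_telescope (N : nat) (p : Z -> R) :
  csum N (fun l => p (l + 1)%Z) + p 1%Z = csum N p + p (Z.of_nat N + 1)%Z.
Proof.
induction N as [|N IH]; [reflexivity |].
rewrite !csum_S, Nat2Z.inj_succ, <- Z.add_1_r; lra.
Qed.

Definition periodic (N : nat) (p : Z -> R) : Prop :=
  forall l : Z, p (l + Z.of_nat N)%Z = p l.

Lemma csum_shift (N : nat) (p : Z -> R) :
  periodic N p -> csum N (fun l => p (l + 1)%Z) = csum N p.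
Proof.
intros Hp; generalize (csum_telescope N p).
rewrite (Z.add_comm (Z.of_nat N)), Hp; lra.
Qed.

Lemma csum_shift_back (N : nat) (p : Z -> R) :
  periodic N p -> csum N (fun l => p (l - 1)%Z) = csum N p.
Proof.
intros Hp; rewrite <- (csum_shift N (fun l => p (l - 1)%Z)).
- apply csum_ext; intros l; f_equal; lia.
- intros l; rewrite <- (Hp (l - 1)%Z); f_equal; lia.
Qed.

Lemma periodic_mult (N : nat) (p : Z -> R) :
  periodic N p -> forall k l : Z, p (l + k * Z.of_nat N)%Z = p l.
Proof.
intros Hp k; induction k using Z.peano_ind; intros l.
- f_equal; lia.
- rewrite <- (IHk l), <- (Hp (l + k * Z.of_nat N)%Z); f_equal; lia.
- rewrite <- (IHk l), <- (Hp (l + Z.pred k * Z.of_nat N)%Z); f_equal; lia.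
Qed.

(** * Scalar displacements and the Rayleigh quotient [T/S] *)

Definition sbdiff (N : nat) (p : Z -> R) : Z -> R :=
  fun l => / eps N * (p l - p (l - 1)%Z).

Definition sq_sum (N : nat) (w : Z -> R) : R := csum N (fun l => w l ^ 2).

Definition pair_sum (N : nat) (w : Z -> R) : R :=
  csum N (fun l => (w (l + 1)%Z + w l) ^ 2).

Definition is_sdisplacement (N : nat) (p : Z -> R) : Prop :=
  periodic N p /\ csum N p = 0.

Definition rayleigh (N : nat) (q : R) : Prop :=
  exists p : Z -> R, is_sdisplacement N p /\ (exists l, p l <> 0) /\
    q = pair_sum N (sbdiff N p) / sq_sum N (sbdiff N p).

Lemma eps_pos (N : nat) : (1 <= N)%nat -> 0 < eps N.
Proof. intros HN; apply Rdiv_lt_0_compat, lt_0_INR; [lra | lia]. Qed.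

Lemma sbdiff_periodic (N : nat) (p : Z -> R) :
  periodic N p -> periodic N (sbdiff N p).
Proof.
intros Hp l; unfold sbdiff; rewrite Hp, <- (Hp (l - 1)%Z).
now rewrite Z.add_sub_swap.
Qed.

Lemma sq_sum_nonneg (N : nat) (w : Z -> R) : 0 <= sq_sum N w.
Proof. apply csum_nonneg; intros l; apply pow2_ge_0. Qed.

Lemma pair_sum_nonneg (N : nat) (w : Z -> R) : 0 <= pair_sum N w.
Proof. apply csum_nonneg; intros l; apply pow2_ge_0. Qed.

(** Termwise [(x + y)^2 <= 2 x^2 + 2 y^2]; the shifted squares have the same sum over a period. *)
Lemma pair_sum_le (N : nat) (w : Z -> R) :
  periodic N w -> pair_sum N w <= 4 * sq_sum N w.
Proof.
intros Hw.
apply Rle_trans with (csum N (fun l => 2 * w (l + 1)%Z ^ 2 + 2 * w l ^ 2)).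
- apply csum_le; intros l.
  assert (0 <= (w (l + 1)%Z - w l) ^ 2) by apply pow2_ge_0; lra.
- rewrite csum_plus, !csum_scal, (csum_shift N (fun l => w l ^ 2)).
  + unfold sq_sum; lra.
  + intros l; now rewrite Hw.
Qed.

(** If all differences over a period vanish, [p] is constant there; the zero mean makes this
    constant 0, and periodicity carries it to all of [Z]. *)
Lemma sq_sum_sbdiff_pos (N : nat) (p : Z -> R) :
  (1 <= N)%nat -> is_sdisplacement N p -> (exists l, p l <> 0) ->
  0 < sq_sum N (sbdiff N p).
Proof.
intros HN [Hp H0] [l Hl].
destruct (sq_sum_nonneg N (sbdiff N p)) as [H | H]; [exact H | exfalso].
assert (Heps := eps_pos N HN).
assert (Hconst : forall n, (n <= N)%nat -> p (Z.of_nat n) = p 0%Z).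
{ induction n as [|n IH]; intros Hn; [reflexivity |].
  rewrite <- IH by lia.
  assert (E : sbdiff N p (Z.of_nat (S n)) ^ 2 = 0).
  { apply (csum_eq0 N (fun l => sbdiff N p l ^ 2)); [| now symmetry | lia].
    intros i; apply pow2_ge_0. }
  rewrite <- Rsqr_pow2 in E; apply Rsqr_0_uniq in E.
  unfold sbdiff in E; apply Rmult_integral in E as [E | E].
  - exfalso; revert E; apply Rgt_not_eq, Rinv_0_lt_compat, Heps.
  - replace (Z.of_nat (S n) - 1)%Z with (Z.of_nat n) in E by lia; lra. }
assert (Hsum : csum N p = INR N * p 0%Z).
{ rewrite <- (Nat.sub_0_r N) at 2; change (N - 0)%nat with (S N - 1)%nat.
  rewrite <- (sum_n_m_const 1 N); apply sum_n_m_ext_loc; intros k Hk.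
  apply Hconst; lia. }
assert (Hp0 : p 0%Z = 0).
{ rewrite H0 in Hsum; symmetry in Hsum; apply Rmult_integral in Hsum as [E | E]; [| exact E].
  apply (not_0_INR N) in E; [contradiction | lia]. }
(* Reduce [l] to its residue modulo [N], an index covered by [Hconst]. *)
apply Hl; rewrite (Z.div_mod l (Z.of_nat N)) by lia.
rewrite Z.add_comm, Z.mul_comm, periodic_mult by exact Hp.
assert (Hm := Z.mod_pos_bound l (Z.of_nat N) ltac:(lia)).
rewrite <- (Z2Nat.id (l mod Z.of_nat N)) by lia.
rewrite Hconst by lia; exact Hp0.
Qed.

Lemma rayleigh_bounds (N : nat) (q : R) :
  (1 <= N)%nat -> rayleigh N q -> 0 <= q <= 4.
Proof.
intros HN [p [Hp [Hl ->]]].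
assert (HS := sq_sum_sbdiff_pos N p HN Hp Hl).
assert (H1 := pair_sum_nonneg N (sbdiff N p)).
assert (H2 := pair_sum_le N (sbdiff N p) (sbdiff_periodic N p (proj1 Hp))).
split.
- now apply Rdiv_le_0_compat.
- now apply Rle_div_l.
Qed.

(* A solution of [w (l + 1) + w (l - 1) = c w l] gives, by summation by parts,
   the Rayleigh quotient [2 + c]. *)
Lemma pair_sum_eigen (N : nat) (w : Z -> R) (c : R) :
  periodic N w -> (forall l, w (l + 1)%Z + w (l - 1)%Z = c * w l) ->
  pair_sum N w = (2 + c) * sq_sum N w.
Proof.
intros Hw Hc.
assert (H1 : csum N (fun l => w (l + 1)%Z ^ 2) = sq_sum N w).
{ apply (csum_shift N (fun l => w l ^ 2)); intros l; now rewrite Hw. }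
assert (H2 : csum N (fun l => w l * w (l - 1)%Z) = csum N (fun l => w (l + 1)%Z * w l)).
{ rewrite <- (csum_shift N (fun l => w l * w (l - 1)%Z)).
  - apply csum_ext; intros l; do 2 f_equal; lia.
  - intros l; rewrite Hw, <- (Hw (l - 1)%Z); do 2 f_equal; lia. }
assert (H3 : csum N (fun l => w (l + 1)%Z * w l) + csum N (fun l => w l * w (l - 1)%Z)
             = c * sq_sum N w).
{ unfold sq_sum; rewrite <- csum_plus, <- csum_scal; apply csum_ext; intros l.
  replace (c * w l ^ 2) with (c * w l * w l) by ring; rewrite <- Hc; ring. }
assert (H4 : pair_sum N w = csum N (fun l => w (l + 1)%Z ^ 2) + sq_sum N w
             + 2 * csum N (fun l => w (l + 1)%Z * w l)).
{ unfold pair_sum, sq_sum; rewrite <- csum_scal, <- !csum_plus.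
  apply csum_ext; intros l; ring. }
lra.
Qed.

(** The cosine mode of frequency [k] satisfies the three-term recurrence with [c = 2 cos theta], and
    so do its differences, so that [pair_sum_eigen] applies. *)
Lemma rayleigh_cos (N k : nat) :
  (0 < k < N)%nat -> rayleigh N (2 + 2 * cos (2 * PI * INR k / INR N)).
Proof.
intros Hk; set (theta := 2 * PI * INR k / INR N).
assert (HN : 0 < INR N) by (apply lt_0_INR; lia).
set (p := fun l : Z => cos (theta * IZR l)).
assert (Hrec : forall l, p (l + 1)%Z + p (l - 1)%Z = 2 * cos theta * p l).
{ intros l; unfold p; rewrite minus_IZR, plus_IZR.
  rewrite Rmult_plus_distr_l, Rmult_minus_distr_l, Rmult_1_r, cos_plus, cos_minus; ring. }
assert (Hper : periodic N p).
{ intros l; unfold p; rewrite <- (cos_period (theta * IZR l) k), plus_IZR, <- INR_IZR_INZ.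
  f_equal; unfold theta; field; lra. }
assert (Hdisp : is_sdisplacement N p).
{ split; [exact Hper |].
  (* Summing the recurrence over a period forces zero mean once [cos theta <> 1], which holds
     because [theta / 2] lies strictly between 0 and [PI]. *)
  assert (E : 2 * csum N p = 2 * cos theta * csum N p).
  { rewrite <- (csum_scal N (2 * cos theta)), <- (csum_ext N _ _ Hrec), csum_plus.
    rewrite csum_shift, csum_shift_back by exact Hper; ring. }
  assert (Hsin : 0 < sin (theta / 2)).
  { assert (H0 : 0 < INR k) by (apply lt_0_INR; lia).
    assert (H1 : INR k < INR N) by (apply lt_INR; lia).
    assert (HPI := PI_RGT_0).
    replace (theta / 2) with (PI * (INR k / INR N)) by (unfold theta; field; lra).
    assert (0 < INR k / INR N) by (apply Rdiv_lt_0_compat; lra).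
    assert (INR k / INR N < 1) by (apply Rlt_div_l; lra).
    apply sin_gt_0; nra. }
  assert (Hcos : cos theta = 1 - 2 * sin (theta / 2) * sin (theta / 2)).
  { rewrite <- cos_2a_sin; f_equal; field. }
  rewrite Hcos in E.
  assert (Hs2 : 0 < sin (theta / 2) * sin (theta / 2)) by now apply Rmult_lt_0_compat.
  assert (Hz : sin (theta / 2) * sin (theta / 2) * csum N p = 0) by lra.
  apply Rmult_integral in Hz as [Hz | Hz]; [lra | exact Hz]. }
assert (Hnz : exists l, p l <> 0).
{ exists 0%Z; unfold p; rewrite Rmult_0_r, cos_0; lra. }
exists p; split; [exact Hdisp | split; [exact Hnz |]].
assert (HS := sq_sum_sbdiff_pos N p ltac:(lia) Hdisp Hnz).
rewrite (pair_sum_eigen N (sbdiff N p) (2 * cos theta)); [field; lra | |].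
- now apply sbdiff_periodic.
- intros l; unfold sbdiff.
  replace (l + 1 - 1)%Z with (l - 1 + 1)%Z by lia.
  assert (H1 := Hrec l); assert (H2 := Hrec (l - 1)%Z).
  replace (2 * cos theta * (/ eps N * (p l - p (l - 1)%Z)))
    with (/ eps N * (2 * cos theta * p l - 2 * cos theta * p (l - 1)%Z)) by ring.
  rewrite <- H1, <- H2; ring.
Qed.

(** * Decoupling of the Hessian into scalar components *)

(** The straight chain has constant difference [(F, 0)], so [c] cancels and every bond takes the
    form of [has_derive2_0_radial] with [X = F] or [X = 2 * F]. *)
Lemma energy_on_line (phi : R -> R) (N : nat) (F c : R) (u : vseq) (s : R) :
  (1 <= N)%nat ->
  let a := sbdiff N (fun l => fst (u l)) in
  let b := sbdiff N (fun l => snd (u l)) in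
  atomistic_energy phi N (fun l => plus (straight_chain N F c l) (scal s (u l))) =
  eps N * sum_n_m (fun n : nat => let l := Z.of_nat n in
    phi (sqrt ((F + s * a l) ^ 2 + (s * b l) ^ 2)) +
    phi (sqrt ((2 * F + s * (a (l + 1)%Z + a l)) ^ 2 + (s * (b (l + 1)%Z + b l)) ^ 2))) 1 N.
Proof.
intros HN a b; assert (Heps := eps_pos N HN).
set (y := fun l => plus (straight_chain N F c l) (scal s (u l))).
assert (H1 : forall l, fst (bdiff N y l) = F + s * a l).
{ intros l; unfold a, sbdiff; cbn; unfold mult; cbn.
  rewrite minus_IZR; field; lra. }
assert (H2 : forall l, snd (bdiff N y l) = s * b l).
{ intros l; unfold b, sbdiff; cbn; unfold mult; cbn; ring. }
unfold atomistic_energy; f_equal; apply sum_n_m_ext; intros n; cbv zeta.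
rewrite !norm_vec2E.
change (fst (plus ?v ?w)) with (fst v + fst w).
change (snd (plus ?v ?w)) with (snd v + snd w).
rewrite !H1, !H2; do 4 f_equal; ring.
Qed.

Lemma second_variation_straight_chain (phi : R -> R) (N : nat) (F c : R) (u : vseq) :
  C2_on_pos phi -> 0 < F -> (1 <= N)%nat ->
  let a := sbdiff N (fun l => fst (u l)) in
  let b := sbdiff N (fun l => snd (u l)) in
  second_variation (atomistic_energy phi N) (straight_chain N F c) u u =
  eps N * ((Derive_n phi 2 F * sq_sum N a + Derive_n phi 2 (2 * F) * pair_sum N a) +
           (Derive phi F / F * sq_sum N b + Derive phi (2 * F) / (2 * F) * pair_sum N b)).
Proof.
intros Hphi HF HN a b.
set (h := fun s => atomistic_energy phi N
            (fun l => plus (straight_chain N F c l) (scal s (u l)))).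
transitivity (Derive (fun s => Derive (fun t => h (s + t)) 0) 0).
{ unfold second_variation; apply Derive_ext; intros s; apply Derive_ext; intros t.
  unfold h; f_equal; apply functional_extensionality; intros l.
  rewrite <- plus_assoc; f_equal; symmetry; exact (scal_distr_r s t (u l)). }
apply Derive_Derive_translate; unfold h.
apply has_derive2_0_ext with (1 := fun s => eq_sym (energy_on_line phi N F c u s HN)).
fold a b; cbv zeta.
apply has_derive2_0_scal.
(* [q] groups the terms by bond, as differentiation produces them; the statement groups them by
   component. *)
set (q := fun l : Z =>
  Derive_n phi 2 F * a l ^ 2 + Derive phi F / F * b l ^ 2 +
  (Derive_n phi 2 (2 * F) * (a (l + 1)%Z + a l) ^ 2 +
   Derive phi (2 * F) / (2 * F) * (b (l + 1)%Z + b l) ^ 2)).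
replace (_ + _) with (csum N q).
- apply (has_derive2_0_sum _ (fun n => q (Z.of_nat n))); intros n.
  apply has_derive2_0_plus; apply has_derive2_0_radial; trivial; lra.
- unfold q, sq_sum, pair_sum; rewrite !csum_plus, !csum_scal; ring.
Qed.

Lemma norm_l2eps_sqr (N : nat) (u : vseq) :
  (1 <= N)%nat ->
  norm_l2eps N (bdiff N u) ^ 2 =
  eps N * (sq_sum N (sbdiff N (fun l => fst (u l))) +
           sq_sum N (sbdiff N (fun l => snd (u l)))).
Proof.
intros HN; assert (Heps := eps_pos N HN).
unfold norm_l2eps; rewrite pow2_sqrt.
- f_equal; unfold sq_sum; rewrite <- csum_plus; apply sum_n_m_ext; intros n.
  rewrite norm_vec2E, pow2_sqrt; [reflexivity |].
  apply Rplus_le_le_0_compat; apply pow2_ge_0.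
- apply Rmult_le_pos; [lra |].
  apply (csum_nonneg N (fun l => norm (bdiff N u l) ^ 2)); intros l; apply pow2_ge_0.
Qed.

Lemma is_displacement_components (N : nat) (u : vseq) :
  is_displacement N u <->
  is_sdisplacement N (fun l => fst (u l)) /\ is_sdisplacement N (fun l => snd (u l)).
Proof.
assert (E : sum_n_m (fun l : nat => u (Z.of_nat l)) 1 N =
            (csum N (fun l => fst (u l)), csum N (fun l => snd (u l)))).
{ unfold csum; induction N as [|N IH].
  - now rewrite !sum_n_m_zero by lia.
  - now rewrite !sum_n_Sm, IH by lia. }
unfold is_displacement, is_sdisplacement, periodic; rewrite E; split.
- intros [Hp H0]; injection H0 as H1 H2.
  repeat split; trivial; intros l; now rewrite Hp.
- intros [[Hp1 H1] [Hp2 H2]]; split.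
  + intros l; apply injective_projections; trivial.
  + now rewrite H1, H2.
Qed.

Lemma sbdiff_0 (N : nat) (l : Z) : sbdiff N (fun _ => 0) l = 0.
Proof. unfold sbdiff; ring. Qed.

Lemma sq_sum_sbdiff_0 (N : nat) : sq_sum N (sbdiff N (fun _ => 0)) = 0.
Proof.
apply eq_trans with (2 := csum_0 N); apply csum_ext; intros l; rewrite sbdiff_0; ring.
Qed.

Lemma pair_sum_sbdiff_0 (N : nat) : pair_sum N (sbdiff N (fun _ => 0)) = 0.
Proof.
apply eq_trans with (2 := csum_0 N); apply csum_ext; intros l; rewrite !sbdiff_0; ring.
Qed.

Lemma sdisplacement_0 (N : nat) : is_sdisplacement N (fun _ => 0).
Proof. split; [now intros l | apply csum_0]. Qed.

(** * Extremal Rayleigh quotients and the exact stability constant *)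

(** [real] sends infinite values to 0; for [2 <= N] the set is nonempty and lies in [[0, 4]], so
    nothing is lost. *)
Definition rayleigh_sup (N : nat) : R := real (Lub_Rbar (rayleigh N)).

Definition rayleigh_inf (N : nat) : R := real (Glb_Rbar (rayleigh N)).

Lemma rayleigh_nonempty (N : nat) : (2 <= N)%nat -> exists q, rayleigh N q.
Proof. intros HN; eexists; apply (rayleigh_cos N 1); lia. Qed.

Lemma rayleigh_sup_lub (N : nat) :
  (2 <= N)%nat -> is_lub_Rbar (rayleigh N) (rayleigh_sup N).
Proof.
intros HN; destruct (rayleigh_nonempty N HN) as [q Hq].
assert (H := Lub_Rbar_correct (rayleigh N)).
unfold rayleigh_sup; destruct (Lub_Rbar (rayleigh N)); [exact H | |]; exfalso.
- refine (proj2 H (Finite 4) _); intros x Hx.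
  apply (rayleigh_bounds N x ltac:(lia) Hx).
- exact (proj1 H q Hq).
Qed.

Lemma rayleigh_inf_glb (N : nat) :
  (2 <= N)%nat -> is_glb_Rbar (rayleigh N) (rayleigh_inf N).
Proof.
intros HN; destruct (rayleigh_nonempty N HN) as [q Hq].
assert (H := Glb_Rbar_correct (rayleigh N)).
unfold rayleigh_inf; destruct (Glb_Rbar (rayleigh N)); [exact H | |]; exfalso.
- exact (proj1 H q Hq).
- refine (proj2 H (Finite 0) _); intros x Hx.
  apply (rayleigh_bounds N x ltac:(lia) Hx).
Qed.

Lemma rayleigh_sup_bounds (N k : nat) :
  (0 < k < N)%nat -> 2 + 2 * cos (2 * PI * INR k / INR N) <= rayleigh_sup N <= 4.
Proof.
intros Hk; destruct (rayleigh_sup_lub N ltac:(lia)) as [H1 H2]; split.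
- exact (H1 _ (rayleigh_cos N k Hk)).
- refine (H2 (Finite 4) _); intros x Hx.
  apply (rayleigh_bounds N x ltac:(lia) Hx).
Qed.

Lemma rayleigh_inf_bounds (N k : nat) :
  (0 < k < N)%nat -> 0 <= rayleigh_inf N <= 2 + 2 * cos (2 * PI * INR k / INR N).
Proof.
intros Hk; destruct (rayleigh_inf_glb N ltac:(lia)) as [H1 H2]; split.
- refine (H2 (Finite 0) _); intros x Hx.
  apply (rayleigh_bounds N x ltac:(lia) Hx).
- exact (H1 _ (rayleigh_cos N k Hk)).
Qed.

(** Clearing the denominator extends the bounds to [p = 0], which is needed because one component of
    a nonzero displacement may vanish. *)
Lemma pair_sum_sbdiff_bounds (N : nat) (p : Z -> R) :
  (2 <= N)%nat -> is_sdisplacement N p ->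
  rayleigh_inf N * sq_sum N (sbdiff N p) <= pair_sum N (sbdiff N p) <=
  rayleigh_sup N * sq_sum N (sbdiff N p).
Proof.
intros HN Hp.
destruct (Classical_Prop.classic (exists l, p l <> 0)) as [Hl | Hl].
- assert (HS := sq_sum_sbdiff_pos N p ltac:(lia) Hp Hl).
  assert (Hq : rayleigh N (pair_sum N (sbdiff N p) / sq_sum N (sbdiff N p)))
    by now exists p.
  split.
  + apply Rle_div_r; [exact HS |]; exact (proj1 (rayleigh_inf_glb N HN) _ Hq).
  + apply Rle_div_l; [exact HS |]; exact (proj1 (rayleigh_sup_lub N HN) _ Hq).
- replace p with (fun _ : Z => 0).
  + rewrite sq_sum_sbdiff_0, pair_sum_sbdiff_0; lra.
  + apply functional_extensionality; intros l; symmetry.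
    apply Classical_Prop.NNPP; intros H; apply Hl; now exists l.
Qed.

(** For [k > 0] the inequality becomes a lower bound on [E]; for [k = 0] any one element of [E]
    gives it. *)
Lemma affine_ge_at_glb (E : R -> Prop) (m k x b : R) :
  (exists q, E q) -> is_glb_Rbar E m -> 0 <= k ->
  (forall q, E q -> x <= b + k * q) -> x <= b + k * m.
Proof.
intros [q0 Hq0] [_ Hm] Hk Hx; destruct Hk as [Hk | <-].
- assert (H : (x - b) / k <= m).
  { refine (Hm (Finite ((x - b) / k)) _); intros q Hq; simpl.
    apply Rle_div_l; [exact Hk |]; specialize (Hx q Hq); lra. }
  apply Rle_div_l in H; [lra | exact Hk].
- specialize (Hx q0 Hq0); lra.
Qed.

Lemma affine_ge_at_lub (E : R -> Prop) (M k x b : R) :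
  (exists q, E q) -> is_lub_Rbar E M -> k <= 0 ->
  (forall q, E q -> x <= b + k * q) -> x <= b + k * M.
Proof.
intros [q0 Hq0] [_ HM] Hk Hx; destruct Hk as [Hk | ->].
- assert (H : M <= (b - x) / - k).
  { refine (HM (Finite ((b - x) / - k)) _); intros q Hq; simpl.
    apply Rle_div_r; [lra |]; specialize (Hx q Hq); lra. }
  apply Rle_div_r in H; lra.
- specialize (Hx q0 Hq0); lra.
Qed.

(** An exact formula for each [N]. The full quotient is a weighted mean of a longitudinal and a
    transverse one, so its infimum is the smaller of their two infima. *)
Lemma stability_constant_straight_chain (phi : R -> R) (N : nat) (F c : R) :
  C2_on_pos phi -> 0 < F ->
  0 <= Derive phi (2 * F) -> Derive_n phi 2 (2 * F) <= 0 -> (2 <= N)%nat ->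
  stability_constant phi N (straight_chain N F c) =
  Finite (Rmin (Derive_n phi 2 F + Derive_n phi 2 (2 * F) * rayleigh_sup N)
               (Derive phi F / F + Derive phi (2 * F) / (2 * F) * rayleigh_inf N)).
Proof.
intros Hphi HF h1 h2 HN.
assert (h1' : 0 <= Derive phi (2 * F) / (2 * F)) by (apply Rdiv_le_0_compat; lra).
assert (Heps := eps_pos N ltac:(lia)).
apply is_glb_Rbar_unique; split.
- intros q [u [Hu [[l Hl] ->]]]; cbn [Rbar_le].
  rewrite second_variation_straight_chain, norm_l2eps_sqr by (trivial; lia).
  apply is_displacement_components in Hu as [Hu1 Hu2].
  assert (B1 := pair_sum_sbdiff_bounds N _ HN Hu1).
  assert (B2 := pair_sum_sbdiff_bounds N _ HN Hu2).
  assert (HS : 0 < sq_sum N (sbdiff N (fun l => fst (u l))) +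
                   sq_sum N (sbdiff N (fun l => snd (u l)))).
  { assert (S1 := sq_sum_nonneg N (sbdiff N (fun l => fst (u l)))).
    assert (S2 := sq_sum_nonneg N (sbdiff N (fun l => snd (u l)))).
    destruct (Req_dec (fst (u l)) 0) as [E1 | E1].
    - apply Rplus_le_lt_0_compat, sq_sum_sbdiff_pos; trivial; [lia |].
      exists l; intros E2; apply Hl; now apply injective_projections.
    - apply Rplus_lt_le_0_compat; trivial.
      apply sq_sum_sbdiff_pos; trivial; [lia | now exists l]. }
  set (S1 := sq_sum N (sbdiff N (fun l => fst (u l)))) in *.
  set (S2 := sq_sum N (sbdiff N (fun l => snd (u l)))) in *.
  assert (HS1 : 0 <= S1) by apply sq_sum_nonneg.
  assert (HS2 : 0 <= S2) by apply sq_sum_nonneg.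
  apply Rle_div_r; [now apply Rmult_lt_0_compat |].
  rewrite <- Rmult_assoc, (Rmult_comm (Rmin _ _)), Rmult_assoc.
  apply Rmult_le_compat_l; [lra |].
  (* With [eps N] cancelled, the components are compared separately: [h2] calls for the upper bound
     on [T], [h1'] for the lower one. *)
  rewrite Rmult_plus_distr_l; apply Rplus_le_compat.
  + apply Rle_trans with (1 := Rmult_le_compat_r _ _ _ HS1 (Rmin_l _ _)).
    assert (H := Rmult_le_compat_neg_l _ _ _ h2 (proj2 B1)); lra.
  + apply Rle_trans with (1 := Rmult_le_compat_r _ _ _ HS2 (Rmin_r _ _)).
    assert (H := Rmult_le_compat_l _ _ _ h1' (proj1 B2)); lra.
- assert (Hne := rayleigh_nonempty N HN).
  intros b Hb.
  (* Purely longitudinal displacements test the first entry of the minimum; purely transverse ones,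
     in [Hb2], test the second. *)
  assert (Hb1 : forall q, rayleigh N q ->
            Rbar_le b (Derive_n phi 2 F + Derive_n phi 2 (2 * F) * q)).
  { intros q [p [Hp [[l Hl] ->]]]; apply Hb.
    exists (fun l => (p l, 0)); split; [| split].
    - apply is_displacement_components; split; [exact Hp | apply sdisplacement_0].
    - exists l; intros E; apply Hl; now injection E.
    - rewrite second_variation_straight_chain, norm_l2eps_sqr by (trivial; lia).
      cbn [fst snd]; rewrite sq_sum_sbdiff_0, pair_sum_sbdiff_0.
      change (sbdiff N (fun l0 => p l0)) with (sbdiff N p).
      assert (HS := sq_sum_sbdiff_pos N p ltac:(lia) Hp (ex_intro _ l Hl)).
      field; repeat split; lra. }
  assert (Hb2 : forall q, rayleigh N q ->
            Rbar_le b (Derive phi F / F + Derive phi (2 * F) / (2 * F) * q)).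
  { intros q [p [Hp [[l Hl] ->]]]; apply Hb.
    exists (fun l => (0, p l)); split; [| split].
    - apply is_displacement_components; split; [apply sdisplacement_0 | exact Hp].
    - exists l; intros E; apply Hl; now injection E.
    - rewrite second_variation_straight_chain, norm_l2eps_sqr by (trivial; lia).
      cbn [fst snd]; rewrite sq_sum_sbdiff_0, pair_sum_sbdiff_0.
      change (sbdiff N (fun l0 => p l0)) with (sbdiff N p).
      assert (HS := sq_sum_sbdiff_pos N p ltac:(lia) Hp (ex_intro _ l Hl)).
      field; repeat split; lra. }
  (* Lower bounds range over [Rbar]: [p_infty] is refuted by an attained quotient and [m_infty] is
     trivial. *)
  destruct b as [b | |].
  + simpl; apply Rmin_glb.
    * now apply affine_ge_at_lub with (E := rayleigh N); [| apply rayleigh_sup_lub | |].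
    * now apply affine_ge_at_glb with (E := rayleigh N); [| apply rayleigh_inf_glb | |].
  + destruct Hne as [q Hq]; destruct (Hb1 q Hq).
  + exact I.
Qed.

(** * Asymptotics of the extremal quotients *)

(** Half-angle formula together with [|sin t| <= t] at [t = x / 2]. *)
Lemma cos_ge_quadratic (x : R) : 0 <= x -> 1 - x ^ 2 / 2 <= cos x.
Proof.
intros Hx.
assert (E : cos x = 1 - 2 * sin (x / 2) * sin (x / 2)).
{ rewrite <- cos_2a_sin; f_equal; field. }
destruct Hx as [Hx | <-]; [| rewrite cos_0; lra].
assert (H1 := sin_lt_x (x / 2) ltac:(lra)).
(* Up to [PI] the sine is nonnegative; beyond it, [x / 2 > 1] suffices. *)
assert (H2 : - (x / 2) < sin (x / 2)).
{ destruct (Rle_or_lt (x / 2) PI) as [H | H].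
  - assert (0 <= sin (x / 2)) by (apply sin_ge_0; lra); lra.
  - assert (HPI := PI2_1); assert (Hs := SIN_bound (x / 2)); lra. }
nra.
Qed.

Lemma rayleigh_sup_asymptotic (N : nat) :
  (2 <= N)%nat -> Rabs (rayleigh_sup N - 4) <= 4 * PI ^ 2 * eps N ^ 2.
Proof.
intros HN; assert (H := rayleigh_sup_bounds N 1 ltac:(lia)).
assert (HN0 : 0 < INR N) by (apply lt_0_INR; lia).
assert (HPI := PI_RGT_0).
replace (2 * PI * INR 1 / INR N) with (2 * PI * eps N) in H
  by (unfold eps; simpl; field; lra).
assert (Heps := eps_pos N ltac:(lia)).
assert (Hc := cos_ge_quadratic (2 * PI * eps N) ltac:(nra)).
apply Rabs_le; lra.
Qed.

(** The mode [k = N/2] alternates in sign, so neighboring differences cancel. *)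
Lemma rayleigh_inf_even (N : nat) :
  (2 <= N)%nat -> Nat.Even N -> rayleigh_inf N = 0.
Proof.
intros HN [k ->].
assert (H := rayleigh_inf_bounds (2 * k) k ltac:(lia)).
assert (Hk : 0 < INR k) by (apply lt_0_INR; lia).
replace (2 * PI * INR k / INR (2 * k)) with PI in H
  by (rewrite mult_INR; simpl; field; lra).
rewrite cos_PI in H; lra.
Qed.

Lemma rayleigh_inf_odd (N : nat) :
  (2 <= N)%nat -> Nat.Odd N -> Rabs (rayleigh_inf N) <= PI ^ 2 * eps N ^ 2.
Proof.
intros HN [k E].
assert (H := rayleigh_inf_bounds N k ltac:(lia)).
assert (HN0 : 0 < INR N) by (apply lt_0_INR; lia).
assert (HPI := PI_RGT_0); assert (Heps := eps_pos N ltac:(lia)).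
assert (EN : INR N = 2 * INR k + 1) by (rewrite E, plus_INR, mult_INR; simpl; ring).
(* With [N = 2 k + 1] the angle misses [PI] by [PI * eps N], and [2 - 2 cos (PI * eps N)] is at most
   [PI^2 * eps N^2]. *)
replace (2 * PI * INR k / INR N) with (- (PI * eps N) + PI) in H.
- rewrite neg_cos, cos_neg in H.
  assert (Hc := cos_ge_quadratic (PI * eps N) ltac:(nra)).
  apply Rabs_le; lra.
- unfold eps; rewrite EN; field; lra.
Qed.

(** * Error terms and conclusion *)

Lemma bigO_eps_scal (k : nat) (P : nat -> Prop) (a : R) (r : nat -> R) :
  bigO_eps k P r -> bigO_eps k P (fun N => a * r N).
Proof.
intros [C [N0 H]]; exists (Rabs a * C), N0; intros N HN HP.
rewrite Rabs_mult, Rmult_assoc; apply Rmult_le_compat_l; [apply Rabs_pos |].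
now apply H.
Qed.

Lemma bigO_eps_S (k : nat) (P : nat -> Prop) (r : nat -> R) :
  bigO_eps (S k) P r -> bigO_eps k P r.
Proof.
(* The sign of [C] is unknown, hence [Rabs C]; the threshold [S N0] ensures [1 <= N], where
   [0 < eps N <= 1]. *)
intros [C [N0 H]]; exists (Rabs C), (S N0); intros N HN HP.
apply Rle_trans with (1 := H N ltac:(lia) HP).
assert (Heps := eps_pos N ltac:(lia)).
assert (Hle : eps N <= 1).
{ unfold eps; apply Rle_div_l; [apply lt_0_INR; lia |].
  rewrite Rmult_1_l; apply (le_INR 1); lia. }
assert (0 < eps N ^ k) by now apply pow_lt.
apply Rle_trans with (Rabs C * eps N ^ S k).
- apply Rmult_le_compat_r, Rle_abs; left; now apply pow_lt.
- apply Rmult_le_compat_l; [apply Rabs_pos |]; simpl; nra.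
Qed.

Lemma bigO_rayleigh_sup (P : nat -> Prop) :
  bigO_eps 2 P (fun N => rayleigh_sup N - 4).
Proof. exists (4 * PI ^ 2), 2%nat; intros N HN _; now apply rayleigh_sup_asymptotic. Qed.

Theorem theorem4p4 (phi : R -> R) (F : R)
  (hphi : C2_on_pos phi) (hF : 0 < F)
  (h1 : 0 <= Derive phi (2 * F)) (h2 : Derive_n phi 2 (2 * F) <= 0) :
  (exists r : nat -> R,
    bigO_eps 2 Nat.Even r /\
    forall (N : nat) (c : R), (2 <= N)%nat -> Nat.Even N ->
      stability_constant phi N (straight_chain N F c) =
      Finite (Rmin (Derive_n phi 2 F + 4 * Derive_n phi 2 (2 * F) + r N)
                   (Derive phi F / F))) /\
  (exists r r' : nat -> R,
    bigO_eps 2 Nat.Odd r /\ bigO_eps 1 Nat.Odd r' /\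
    forall (N : nat) (c : R), (2 <= N)%nat -> Nat.Odd N ->
      stability_constant phi N (straight_chain N F c) =
      Finite (Rmin (Derive_n phi 2 F + 4 * Derive_n phi 2 (2 * F) + r N)
                   (Derive phi F / F + r' N))).
Proof.
(* The errors are read off the exact formula, with 4 and 0 as the limits of the extremal quotients;
   neither depends on [c]. *)
set (r := fun N => Derive_n phi 2 (2 * F) * (rayleigh_sup N - 4)).
set (r' := fun N => Derive phi (2 * F) / (2 * F) * rayleigh_inf N).
split.
- exists r; split; [apply bigO_eps_scal, bigO_rayleigh_sup |].
  intros N c HN Heven.
  rewrite stability_constant_straight_chain, rayleigh_inf_even by trivial.
  do 2 f_equal; unfold r; ring.
- exists r, r'; split; [apply bigO_eps_scal, bigO_rayleigh_sup | split].
  (* The transverse error is in fact of second order, and is weakened to first order here. *)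
  + apply bigO_eps_S, bigO_eps_scal.
    exists (PI ^ 2), 2%nat; exact rayleigh_inf_odd.
  + intros N c HN Hodd.
    rewrite stability_constant_straight_chain by trivial.
    do 2 f_equal; unfold r; ring.
Qed.
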